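(* Let $(\mathcal{A},\mu)$ be a totally associative $3$-ary algebra over $\mathcal{K}$, let $V$ be a $\mathcal{K}$-vector space, and let $\mathcal{L}:\mathcal{A}\otimes\mathcal{A}\otimes V\to V$, $\mathcal{M}:\mathcal{A}\otimes V\otimes\mathcal{A}\to V$, $\mathcal{R}:V\otimes\mathcal{A}\otimes\mathcal{A}\to V$ be linear maps, written $\mathcal{L}(x,y)(v)$, $\mathcal{M}(x,y)(v)$, $\mathcal{R}(x,y)(v)$ for the values at $x\otimes y\otimes v$, $x\otimes v\otimes y$, $v\otimes x\otimes y$ respectively. Then $(\mathcal{L},\mathcal{M},\mathcal{R},V)$ is a trimodule of $(\mathcal{A},\mu)$ if and only if the direct sum $\mathcal{A}\oplus V$ with the trilinear product $$\tau[(x+a),(y+b),(z+c)]=\mu(x,y,z)+\mathcal{L}(x,y)(c)+\mathcal{M}(x,z)(b)+\mathcal{R}(y,z)(a),\qquad x,y,z\in\mathcal{A},\ a,b,c\in V,$$ is a totally associative $3$-ary algebra.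
   Context: $\mathcal{K}$ is a fixed field of characteristic zero. A totally associative $3$-ary algebra is a $\mathcal{K}$-vector space $\mathcal{A}$ with a trilinear operation $\mu$ satisfying $\mu(\mu(x_1,x_2,x_3),x_4,x_5)=\mu(x_1,\mu(x_2,x_3,x_4),x_5)=\mu(x_1,x_2,\mu(x_3,x_4,x_5))$ for all $x_i\in\mathcal{A}$. $(\mathcal{L},\mathcal{M},\mathcal{R},V)$ is a trimodule of the totally associative $3$-ary algebra $(\mathcal{A},\mu)$ if for all $a,b,c,d,x,y,z\in\mathcal{A}$, $v\in V$: $\mathcal{L}(a,b)(\mathcal{L}(c,d)(v))=\mathcal{L}(\mu(a,b,c),d)(v)=\mathcal{L}(a,\mu(b,c,d))(v)$; $\mathcal{R}(c,d)(\mathcal{R}(a,b)(v))=\mathcal{R}(a,\mu(b,c,d))(v)=\mathcal{R}(\mu(a,b,c),d)(v)$; $\mathcal{M}(a,z)(\mathcal{M}(b,y)(\mathcal{M}(c,x)(v)))=\mathcal{M}(\mu(a,b,c),\mu(x,y,z))(v)$; $\mathcal{M}(a,d)(\mathcal{L}(b,c)(v))=\mathcal{L}(a,b)(\mathcal{M}(c,d)(v))=\mathcal{M}(\mu(a,b,c),d)(v)$; $\mathcal{M}(a,d)(\mathcal{R}(b,c)(v))=\mathcal{R}(c,d)(\mathcal{M}(a,b)(v))=\mathcal{M}(a,\mu(b,c,d))(v)$; $\mathcal{R}(c,d)(\mathcal{L}(a,b)(v))=\mathcal{L}(a,b)(\mathcal{R}(c,d)(v))=\mathcal{M}(a,d)(\mathcal{M}(b,c)(v))$.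 *)

(* Defs.v *)
From mathcomp Require Import all_boot all_order all_algebra.

Set Implicit Arguments.
Unset Strict Implicit.
Unset Printing Implicit Defensive.

Import GRing.Theory.
Local Open Scope ring_scope.

(* A linear map U1 (x) U2 (x) U3 -> W on a tensor product is represented by
   the corresponding curried trilinear map. *)
Definition trilinear (K : fieldType) (U1 U2 U3 W : lmodType K)
    (f : U1 -> U2 -> U3 -> W) : Prop :=
  [/\ forall y z, linear (fun x => f x y z),
      forall x z, linear (fun y => f x y z)
    & forall x y, linear (fun z => f x y z)].

Definition totally_associative (T : Type) (mu : T -> T -> T -> T) : Prop :=
  forall x1 x2 x3 x4 x5 : T,
    mu (mu x1 x2 x3) x4 x5 = mu x1 (mu x2 x3 x4) x5
    /\ mu x1 (mu x2 x3 x4) x5 = mu x1 x2 (mu x3 x4 x5).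

Definition tot_assoc_3alg (K : fieldType) (A : lmodType K)
    (mu : A -> A -> A -> A) : Prop :=
  trilinear mu /\ totally_associative mu.

(* Argument order: [L x y v], [M x y v] and [R x y v] stand for L(x,y)(v),
   M(x,y)(v) and R(x,y)(v), the values of the three maps at x (x) y (x) v,
   x (x) v (x) y and v (x) x (x) y.  Trilinearity does not depend on the order
   of the arguments; it is not part of [trimodule] and is to be assumed
   separately. *)
Record trimodule (K : fieldType) (A V : lmodType K)
    (mu : A -> A -> A -> A) (L M R : A -> A -> V -> V) : Prop := Trimodule {
  trimod_LL : forall a b c d v,
    L a b (L c d v) = L (mu a b c) d v
    /\ L (mu a b c) d v = L a (mu b c d) v;
  trimod_RR : forall a b c d v,
    R c d (R a b v) = R a (mu b c d) v
    /\ R a (mu b c d) v = R (mu a b c) d v;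
  trimod_MMM : forall a b c x y z v,
    M a z (M b y (M c x v)) = M (mu a b c) (mu x y z) v;
  trimod_ML : forall a b c d v,
    M a d (L b c v) = L a b (M c d v)
    /\ L a b (M c d v) = M (mu a b c) d v;
  trimod_MR : forall a b c d v,
    M a d (R b c v) = R c d (M a b v)
    /\ R c d (M a b v) = M a (mu b c d) v;
  trimod_RL : forall a b c d v,
    R c d (L a b v) = L a b (R c d v)
    /\ L a b (R c d v) = M a d (M b c v)
}.

(* The direct sum of A and V is the product module [A * V]; the element x + a
   is the pair (x, a). *)
Definition semidirect_prod (K : fieldType) (A V : lmodType K)
    (mu : A -> A -> A -> A) (L M R : A -> A -> V -> V)
    (p q r : A * V) : A * V :=
  (mu p.1 q.1 r.1, L p.1 q.1 r.2 + M p.1 r.1 q.2 + R q.1 r.1 p.2).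

(* Main.v *)
(** Splitting an instance of total associativity on [A * V] by the position of
    its vector entry gives one pair of trimodule axioms for each of the five
    positions.  The remaining axiom follows from these:
    M(a,z) M(b,y) M(c,x) = L(a,b) R(y,z) M(c,x) = L(a,b) M(c, mu(x,y,z))
                         = M(mu(a,b,c), mu(x,y,z)). *)
Require Import Defs.
From mathcomp Require Import all_boot all_order all_algebra.

Set Implicit Arguments.
Unset Strict Implicit.
Unset Printing Implicit Defensive.

Import GRing.Theory.
Local Open Scope ring_scope.

Section Trilinear.
Variables (K : fieldType) (U1 U2 U3 W : lmodType K) (f : U1 -> U2 -> U3 -> W).
Hypothesis hf : trilinear f.

Lemma trilinearP1 k x x' y z : f (k *: x + x') y z = k *: f x y z + f x' y z.
Proof. by case: hf => h _ _; exact: h. Qed.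

Lemma trilinearP2 k x y y' z : f x (k *: y + y') z = k *: f x y z + f x y' z.
Proof. by case: hf => _ h _; exact: h. Qed.

Lemma trilinearP3 k x y z z' : f x y (k *: z + z') = k *: f x y z + f x y z'.
Proof. by case: hf => _ _ h; exact: h. Qed.

(** The third slot of [L], [M], [R] holds the vector, and nesting two products on [A * V] creates
    sums only there. *)
Lemma trilinearD3 x y z z' : f x y (z + z') = f x y z + f x y z'.
Proof. by rewrite -[z]scale1r trilinearP3 !scale1r. Qed.

Lemma trilinear03 x y : f x y 0 = 0.
Proof. by apply: (addrI (f x y 0)); rewrite -trilinearD3 !addr0. Qed.

End Trilinear.

Section Semidirect.
Variables (K : fieldType) (A V : lmodType K) (mu : A -> A -> A -> A).
Variables L M R : A -> A -> V -> V.
Hypotheses (hL : trilinear L) (hM : trilinear M) (hR : trilinear R).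

Lemma semidirect_prod_trilinear :
  trilinear mu -> trilinear (semidirect_prod mu L M R).
Proof.
have add3 k (a b c a' b' c' : V) : (k *: a + a') + (k *: b + b') +
    (k *: c + c') = k *: (a + b + c) + (a' + b' + c').
  by rewrite !scalerDr (addrACA _ a') (addrACA _ (a' + b')).
have pair_eq (p q : A * V) : p.1 = q.1 -> p.2 = q.2 -> p = q.
  by case: p q => [? ?] [? ?] /= -> ->.
move=> hmu; split=> p q k u v; apply: pair_eq => /=.
- exact: trilinearP1.
(* The [V]-part of an argument enters exactly one of [L], [M], [R], through slot 3; its [A]-part
   enters the other two. *)
- by rewrite (trilinearP1 hL) (trilinearP1 hM) (trilinearP3 hR) add3.
- exact: trilinearP2.
- by rewrite (trilinearP2 hL) (trilinearP3 hM) (trilinearP1 hR) add3.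
- exact: trilinearP3.
- by rewrite (trilinearP3 hL) (trilinearP2 hM) (trilinearP2 hR) add3.
Qed.

Lemma semidirect_prod_assoc :
  totally_associative mu -> trimodule mu L M R ->
  totally_associative (semidirect_prod mu L M R).
Proof.
move=> hmu [LL RR _ ML MR RL].
move=> [x1 v1] [x2 v2] [x3 v3] [x4 v4] [x5 v5].
have [mu1 mu2] := hmu x1 x2 x3 x4 x5.
(* Each pair of axioms equates the terms in one [vi] across the three bracketings. *)
have [LL1 LL2] := LL x1 x2 x3 x4 v5; have [RR1 RR2] := RR x2 x3 x4 x5 v1.
have [ML1 ML2] := ML x1 x2 x3 x5 v4; have [MR1 MR2] := MR x1 x3 x4 x5 v2.
have [RL1 RL2] := RL x1 x2 x4 x5 v3.
rewrite /semidirect_prod /= !(trilinearD3 hL) !(trilinearD3 hM).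
rewrite !(trilinearD3 hR) mu1 mu2 LL1 LL2 RR1 RR2 ML1 ML2 MR1 MR2 RL1 RL2.
(* All three bracketings list their terms in the order [v5], ..., [v1], so only parentheses
   differ. *)
by rewrite !addrA.
Qed.

Lemma trimodule_of_semidirect_assoc :
  totally_associative (semidirect_prod mu L M R) -> trimodule mu L M R.
Proof.
move=> h.
have snd_assoc p1 p2 p3 p4 p5 := let: conj e e' := h p1 p2 p3 p4 p5 in
  conj (congr1 snd e) (congr1 snd e').
(* With a single nonzero vector entry, every unwanted term has 0 in its vector slot, including those
   where the zero [A]-part beside [v] occurs. *)
have vec0 := (trilinear03 hL, trilinear03 hM, trilinear03 hR, add0r, addr0).
have LL a b c d v : L a b (L c d v) = L (mu a b c) d v
    /\ L (mu a b c) d v = L a (mu b c d) v.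
  have := snd_assoc (a, 0) (b, 0) (c, 0) (d, 0) (0, v).
  (* The axioms list the three bracketings in another order; both outer ones are rewritten to the
     middle one. *)
  by rewrite /= !vec0 => -[-> <-].
have RR a b c d v : R c d (R a b v) = R a (mu b c d) v
    /\ R a (mu b c d) v = R (mu a b c) d v.
  have := snd_assoc (0, v) (a, 0) (b, 0) (c, 0) (d, 0).
  by rewrite /= !vec0 => -[-> <-].
have ML a b c d v : M a d (L b c v) = L a b (M c d v)
    /\ L a b (M c d v) = M (mu a b c) d v.
  have := snd_assoc (a, 0) (b, 0) (c, 0) (0, v) (d, 0).
  by rewrite /= !vec0 => -[-> <-].
have MR a b c d v : M a d (R b c v) = R c d (M a b v)
    /\ R c d (M a b v) = M a (mu b c d) v.
  have := snd_assoc (a, 0) (0, v) (b, 0) (c, 0) (d, 0).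
  by rewrite /= !vec0 => -[-> <-].
have RL a b c d v : R c d (L a b v) = L a b (R c d v)
    /\ L a b (R c d v) = M a d (M b c v).
  have := snd_assoc (a, 0) (b, 0) (0, v) (c, 0) (d, 0).
  by rewrite /= !vec0 => -[-> <-].
split=> // a b c x y z v.
by rewrite -(RL _ _ _ _ _).2 (MR _ _ _ _ _).2 (ML _ _ _ _ _).2.
Qed.

End Semidirect.

Theorem proposition3p2 (K : fieldType) (charK0 : [pchar K] =i pred0)
    (A V : lmodType K) (mu : A -> A -> A -> A) (hA : tot_assoc_3alg mu)
    (L M R : A -> A -> V -> V)
    (hL : trilinear L) (hM : trilinear M) (hR : trilinear R) :
  trimodule mu L M R <->
  tot_assoc_3alg (semidirect_prod mu L M R).
Proof.
case: hA => mu_lin mu_assoc; split=> [hmod|[_ hassoc]].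
- by split; [exact: semidirect_prod_trilinear | exact: semidirect_prod_assoc].
- exact: trimodule_of_semidirect_assoc hassoc.
Qed.
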